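(* Let $p\ge1$ be an integer, let $\boldsymbol{\beta}=(\beta_0,\ldots,\beta_{p-1})$ be an alternate base, set $\beta=\prod_{i=0}^{p-1}\beta_i$, and suppose $\beta_0,\ldots,\beta_{p-1}\in\mathbb Q(\beta)$. If $\beta$ is an algebraic integer that is neither a Pisot number nor a Salem number, then $\mathrm{Per}(\boldsymbol{\beta})\cap\mathbb Q$ is nowhere dense in $[0,1)$.
   Context: An alternate base is a $p$-tuple $\boldsymbol{\beta}=(\beta_0,\ldots,\beta_{p-1})$ of real numbers $\beta_i>1$, with indices taken modulo $p$ ($\beta_n=\beta_{n\bmod p}$). For $x\in[0,1)$, the greedy $\boldsymbol{\beta}$-expansion $d_{\boldsymbol{\beta}}(x)=(\varepsilon_n)_{n\in\mathbb N}$ is defined by $r_0=x$, $\varepsilon_n=\lfloor\beta_n r_n\rfloor$, $r_{n+1}=\beta_n r_n-\varepsilon_n$. $\mathrm{Per}(\boldsymbol{\beta})$ is the set of $x\in[0,1)$ such that $d_{\boldsymbol{\beta}}(x)$ is ultimately periodic. A Pisot number is an algebraic integer $\beta>1$ all of whose Galois conjugates other than $\beta$ have modulus $<1$; a Salem number is an algebraic integer $\beta>1$ all of whose Galois conjugates other than $\beta$ have modulus $\le1$, with equality for at least one of them. *)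

(* Defs.v *)
From HB Require Import structures.
From mathcomp Require Import all_boot all_order all_algebra.
From mathcomp Require Export complex.
From mathcomp Require Import all_classical all_reals all_analysis.

Set Implicit Arguments.
Unset Strict Implicit.
Unset Printing Implicit Defensive.

Import Order.TTheory GRing.Theory Num.Theory numFieldNormedType.Exports.

Local Open Scope classical_set_scope.
Local Open Scope ring_scope.

Definition algebraic_integer (R : realType) (x : R) : Prop :=
  integralOver (intr : int -> R) x.

(* [q] is the minimal polynomial of [x] over the rationals. Every root of [q]
   counts as a conjugate of [x], including [x] itself. *)
Definition galois_conjugate (R : realType) (x : R) (z : R[i]) : Prop :=
  exists q : {poly rat},
    [/\ q \is monic, irreducible_poly q,
        root (map_poly (ratr : rat -> R) q) x
      & root (map_poly (ratr : rat -> R[i]) q) z].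

Definition pisot (R : realType) (b : R) : Prop :=
  [/\ algebraic_integer b, 1 < b
    & forall z : R[i], galois_conjugate b z -> z != b%:C%C ->
        ComplexField.Normc.normc z < 1].

Definition salem (R : realType) (b : R) : Prop :=
  [/\ algebraic_integer b, 1 < b,
      forall z : R[i], galois_conjugate b z -> z != b%:C%C ->
        ComplexField.Normc.normc z <= 1
    & exists z : R[i], [/\ galois_conjugate b z, z != b%:C%C
        & ComplexField.Normc.normc z = 1]].

(* The subfield of [R] generated by [b]. *)
Definition rational_adjoin (R : realType) (b : R) : set R :=
  [set x | exists f g : {poly rat},
     (map_poly ratr g).[b] != 0 /\
     x = (map_poly ratr f).[b] / (map_poly ratr g).[b]].

Definition alternate_base (R : realType) (p : nat) (beta : p.-tuple R) : Prop :=
  forall i : 'I_p, 1 < tnth beta i.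

(* The default value of [nth] is never reached when [0 < p]. *)
Definition base_at (R : realType) (p : nat) (beta : p.-tuple R) (n : nat) : R :=
  nth 0 beta (n %% p)%N.

Fixpoint greedy_remainder (R : realType) (p : nat) (beta : p.-tuple R)
    (x : R) (n : nat) : R :=
  if n is m.+1 then
    let y := base_at beta m * greedy_remainder beta x m in
    y - (Num.floor y)%:~R
  else x.

Definition greedy_digit (R : realType) (p : nat) (beta : p.-tuple R)
    (x : R) (n : nat) : int :=
  Num.floor (base_at beta n * greedy_remainder beta x n).

Definition ultimately_periodic (T : Type) (u : nat -> T) : Prop :=
  exists N k : nat, (0 < k)%N /\ forall n, (N <= n)%N -> u (n + k)%N = u n.

Definition Per (R : realType) (p : nat) (beta : p.-tuple R) : set R :=
  [set x | 0 <= x < 1 /\ ultimately_periodic (greedy_digit beta x)].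

Definition nowhere_dense (T : topologicalType) (A : set T) : Prop :=
  interior (closure A) = set0.

(* [subspace X] makes the points outside [X] isolated, so for [A `<=` X both
   closure and interior are those of the relative topology of [X]. *)
Definition nowhere_dense_in (T : topologicalType) (X A : set T) : Prop :=
  A `<=` X /\ @nowhere_dense (subspace X) A.

(* Main.v *)
Require Import Defs.
From HB Require Import structures.
From mathcomp Require Import all_boot all_order all_algebra.
From mathcomp Require Import all_classical all_reals all_analysis.
From mathcomp Require Import ring lra.

Import Order.TTheory GRing.Theory Num.Theory numFieldNormedType.Exports.

Local Open Scope classical_set_scope.
Local Open Scope ring_scope.

(* Since [b] is neither Pisot nor Salem it has a conjugate [z <> b] with [|z| > 1]; extend [b |-> z]
   to a field embedding [sigma : Q(b) -> C]. Let [r_n] be the greedy remainders of a rational [y]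
   with ultimately periodic expansion. One period of the base turns [sigma (r_(n p))] into
   [z * sigma (r_(n p))] up to a bounded error, so periodicity confines it to a disc of radius [K]
   independent of [y]. If such [y] were dense in an interval, take in it a point [x] whose
   expansion terminates; for [y] just right of [x] we have [r_(n p)(y) = b^n (y - x)], whence
   [|z^n (y - sigma x)| <= K], and [y -> x], [n -> oo] give [sigma x = x]. The point [x + b^-n] also
   terminates for large [n], so [z^-n = b^-n] for all large [n], forcing [z = b]. *)

Lemma expr_unbounded (R : realType) (a c : R) : 1 < a ->
  exists n, forall m, (n <= m)%N -> c < a ^+ m.
Proof.
move=> a1; have a0 : 0 < a - 1 by rewrite subr_gt0.
have bernoulli m : 1 + (a - 1) *+ m <= a ^+ m.
  elim: m => [|m IHm]; first by rewrite mulr0n expr0 addr0.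
  rewrite exprS mulrSr; apply: le_trans (_ : a * (1 + (a - 1) *+ m) <= _).
    have := mulrn_wge0 m (ltW a0); nra.
  by rewrite ler_pM2l //; lra.
set t := c / (a - 1).
exists (Num.bound `|t|) => m lem; apply: lt_le_trans (bernoulli m).
have : t < m%:R.
  apply: le_lt_trans (ler_norm _) _; apply: lt_le_trans (archi_boundP _) _ => //.
  by rewrite ler_nat.
rewrite ltr_pdivrMr // mulrC mulr_natr; lra.
Qed.

(** * Greedy digits and remainders over an alternate base *)

Section Greedy.
Variables (R : realType) (p : nat) (beta : p.-tuple R).
Hypothesis beta_gt1 : forall n, 1 < base_at beta n.

Local Notation r := (greedy_remainder beta).

Definition base_prod n : R := \prod_(i < n) base_at beta i.

Lemma base_prodS n : base_prod n.+1 = base_prod n * base_at beta n.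
Proof. by rewrite /base_prod big_ord_recr. Qed.

Lemma base_prod0 : base_prod 0 = 1.
Proof. by rewrite /base_prod big_ord0. Qed.

Lemma base_prod_gt0 n : 0 < base_prod n.
Proof. by apply: prodr_gt0 => i _; apply: lt_trans (beta_gt1 i). Qed.

Lemma base_at_gt0 n : 0 < base_at beta n.
Proof. exact: lt_trans (beta_gt1 n). Qed.

Lemma base_prodD m n :
  (p %| m)%N -> base_prod (m + n) = base_prod m * base_prod n.
Proof.
move=> /dvdnP[k ->]; elim: n => [|n IHn]; first by rewrite addn0 base_prod0 mulr1.
by rewrite addnS !base_prodS IHn mulrA /base_at modnMDl.
Qed.

Lemma base_prod_mul n : base_prod (n * p) = base_prod p ^+ n.
Proof.
elim: n => [|n IHn]; first by rewrite mul0n base_prod0.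
by rewrite mulSn exprS base_prodD ?IHn.
Qed.

Lemma base_prod_le m n : (m <= n)%N -> base_prod m <= base_prod n.
Proof.
move=> /subnKC <-; elim: (n - m)%N => [|k IHk]; first by rewrite addn0.
rewrite addnS base_prodS (le_trans IHk) // ler_peMr //.
  exact/ltW/base_prod_gt0.
exact/ltW.
Qed.

Lemma base_prod_gt1 n : (0 < n)%N -> 1 < base_prod n.
Proof.
move=> /base_prod_le; apply: lt_le_trans.
by rewrite base_prodS base_prod0 mul1r.
Qed.

Lemma greedy_remainder_bound (x : R) n : 0 <= x < 1 -> 0 <= r x n < 1.
Proof.
move=> x01; elim: n => [|n _] //=; set y := (_ * _).
have := floor_itv y; rewrite rmorphD /= => /andP[? ?]; apply/andP; split; lra.
Qed.

Lemma greedy_remainderS_eq0 (x : R) n : r x n = 0 -> r x n.+1 = 0.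
Proof. by move=> /= ->; rewrite mulr0 floor0 subr0. Qed.

Lemma greedy_remainder_eq0 (x : R) m n : r x m = 0 -> (m <= n)%N -> r x n = 0.
Proof.
move=> x0 /subnKC <-; elim: (n - m)%N => [|k IHk]; first by rewrite addn0.
by rewrite addnS; exact: greedy_remainderS_eq0.
Qed.

(* The digit [n] is unchanged as long as the translated remainder stays in [0, 1). *)
Lemma greedy_remainder_translate (x u : R) n :
  r (x + u) n = r x n + base_prod n * u ->
  0 <= r x n.+1 + base_prod n.+1 * u < 1 ->
  r (x + u) n.+1 = r x n.+1 + base_prod n.+1 * u.
Proof.
rewrite base_prodS /= => -> /andP[h0 h1].
set f := Num.floor (base_at beta n * r x n) in h0 h1 *.
suff -> : Num.floor (base_at beta n * (r x n + base_prod n * u)) = f by lra.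
by apply: floor_def; rewrite rmorphD /=; apply/andP; split; lra.
Qed.

(** A floor is unchanged by a small enough increase of its argument, so finitely many digits are
    stable to the right of [x]. *)
Lemma greedy_remainder_right_affine (x : R) n : 0 <= x < 1 ->
  exists2 d, 0 < d & forall u, 0 <= u < d -> r (x + u) n = r x n + base_prod n * u.
Proof.
move=> x01; elim: n => [|n [d d0 IHn]].
  by exists 1 => // u _; rewrite base_prod0 mul1r.
have /andP[r0 r1] := greedy_remainder_bound _ n.+1 x01.
have B0 := base_prod_gt0 n.+1.
(* The second bound keeps the translated remainder of rank [n.+1] below 1. *)
exists (Num.min d ((1 - r x n.+1) / base_prod n.+1)).
  by rewrite lt_min d0 divr_gt0 // subr_gt0.
move=> u /andP[u0]; rewrite lt_min ltr_pdivlMr // => /andP[ud ud'].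
apply: greedy_remainder_translate; first by apply: IHn; rewrite u0.
have := mulr_ge0 (ltW B0) u0; apply: contraTT; lra.
Qed.

(** Lowering the remainder of rank [n] without making it negative changes none of the first [n]
    digits. *)
Lemma greedy_remainder_left_affine (x t : R) n : 0 <= x < 1 -> 0 <= t <= r x n ->
  r (x - t / base_prod n) n = r x n - t.
Proof.
move=> x01; elim: n t => [|n IHn] t /andP[t0 tr].
  by rewrite base_prod0 divr1.
have /andP[_ r1] := greedy_remainder_bound _ n.+1 x01.
have b0 := base_at_gt0 n; have B0 := base_prod_gt0 n.
have BE : base_prod n * (- (t / base_prod n.+1)) = - (t / base_at beta n).
  by rewrite base_prodS; field; rewrite !gt_eqF.
have BE' : base_prod n.+1 * (- (t / base_prod n.+1)) = - t.
  by field; rewrite gt_eqF // base_prod_gt0.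
rewrite greedy_remainder_translate ?BE ?BE' //; last by apply/andP; split; lra.
have -> : t / base_prod n.+1 = (t / base_at beta n) / base_prod n.
  by rewrite base_prodS; field; rewrite !gt_eqF.
apply: IHn; rewrite divr_ge0 //=; last exact: ltW.
(* The digit is nonnegative, so [t] is at most the base element times the previous remainder. *)
rewrite ler_pdivrMr //; apply: (le_trans tr); rewrite /= mulrC gerBl ler0z.
rewrite floor_ge0 mulr_ge0 ?(ltW b0) //.
by have /andP[] := greedy_remainder_bound _ n x01.
Qed.

(** The point in question is the left end of the set of points sharing the first [n] digits of [x].
    It provides terminating expansions close to any [x]. *)
Lemma greedy_truncate (x : R) n : 0 <= x < 1 ->
  r (x - r x n / base_prod n) n = 0.
Proof.
move=> x01; rewrite greedy_remainder_left_affine ?subrr //.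
by have /andP[-> _] := greedy_remainder_bound _ n x01; rewrite lexx.
Qed.

(** For large [n] the added term changes no digit before index [n * p - 1]; there it produces the
    digit 1 exactly, and nothing remains. *)
Lemma greedy_append_digit (x : R) m : (0 < p)%N -> 0 <= x < 1 -> r x (m * p) = 0 ->
  exists N, forall n, (N <= n)%N -> r (x + base_prod p ^- n) (n * p) = 0.
Proof.
move=> p0 x01 xm; have [d d0 hd] := greedy_remainder_right_affine _ (m * p) x01.
have Bp1 : 1 < base_prod p.
  exact: base_prod_gt1.
have [N hN] := expr_unbounded _ _ d^-1 Bp1.
(* [N] makes the added term smaller than [d]; [m.+1] puts the new digit after the terminated
   part. *)
exists (maxn N m.+1) => n; rewrite geq_max => /andP[Nn mn].
set u := base_prod p ^- n.
have u0 : 0 < u by rewrite invr_gt0 exprn_gt0 // base_prod_gt0.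
have ud : u < d by rewrite invf_plt ?hN // posrE ?exprn_gt0 ?base_prod_gt0.
have aff k : (m * p + k < n * p)%N ->
    r (x + u) (m * p + k) = base_prod (m * p + k) * u.
  elim: k => [|k IHk] lek; first by rewrite addn0 hd ?xm ?add0r // (ltW u0).
  have z0 j : (r x (m * p + j)) = 0 by apply: greedy_remainder_eq0 _ _ _ xm _; rewrite leq_addr.
  rewrite addnS in lek *.
  rewrite greedy_remainder_translate -?addnS ?z0 ?add0r //.
    by rewrite IHk // ltnW.
  rewrite mulr_ge0 ?(ltW u0) ?(ltW (base_prod_gt0 _)) //=.
  rewrite ltr_pdivrMr ?exprn_gt0 ?base_prod_gt0 // mul1r -base_prod_mul.
  apply: lt_le_trans (base_prod_le _ _ lek); rewrite addnS [X in _ < X]base_prodS.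
  by rewrite ltr_pMr ?base_prod_gt0.
have np0 : (0 < n * p)%N by rewrite muln_gt0 p0 andbT (leq_trans _ mn).
have mnp : (m * p <= (n * p).-1)%N by rewrite -ltnS prednK // ltn_pmul2r.
have E : base_prod (n * p) * u = 1.
  by rewrite base_prod_mul divff // gt_eqF // exprn_gt0 // base_prod_gt0.
rewrite -(prednK np0) in E *; rewrite base_prodS in E.
have := aff ((n * p).-1 - m * p)%N; rewrite subnKC // => aff'.
rewrite /= aff' ?prednK //.
by rewrite mulrCA mulrA E floor1 subrr.
Qed.
(** While the digits agree, the difference of two remainders is multiplied by the base at each step.
    It stays bounded by 1, so it is zero. *)
Lemma Per_remainder_periodic (x : R) : (0 < p)%N -> Per beta x ->
  exists N k, (0 < k)%N /\
    forall n, (N <= n)%N -> r x ((n + k) * p) = r x (n * p).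
Proof.
move=> p0 [x01 [N [k [k0 perk]]]].
have perkp n j : (N <= n)%N -> greedy_digit beta x (n + k * j) = greedy_digit beta x n.
  move=> Nn; elim: j => [|j IHj]; first by rewrite muln0 addn0.
  by rewrite mulnS addnCA addnC perk // (leq_trans Nn) ?leq_addr.
exists N, k; split=> // n Nn; apply/eqP; rewrite -subr_eq0; set d := _ - _.
have dE j : r x ((n + k) * p + j) - r x (n * p + j) = base_prod j * d.
  elim: j => [|j IHj]; first by rewrite !addn0 base_prod0 mul1r.
  have dig : greedy_digit beta x ((n + k) * p + j) = greedy_digit beta x (n * p + j).
    rewrite mulnDl -addnA [(k * p + j)%N]addnC addnA perkp //.
    by rewrite (leq_trans Nn) // (leq_trans (leq_pmulr n p0)) ?leq_addr.
  rewrite !addnS /= -!/(greedy_digit beta x _) dig base_prodS.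
  by rewrite mulrAC -IHj /base_at !modnMDl; ring.
apply/negP => /negP dN0; have d0 : 0 < `|d| by rewrite normr_gt0.
have [j hj] := expr_unbounded _ _ `|d|^-1 (base_prod_gt1 _ p0).
have := hj j (leqnn j); rewrite -[_^-1]mul1r ltr_pdivrMr // -base_prod_mul.
rewrite -[X in X * _](gtr0_norm (base_prod_gt0 _)) -normrM -dE.
have /andP[? ?] := greedy_remainder_bound _ ((n + k) * p + j * p) x01.
have /andP[? ?] := greedy_remainder_bound _ (n * p + j * p) x01.
by apply/negP; rewrite -leNgt ler_norml; apply/andP; split; lra.
Qed.

(** A digit is at most its base element, and the other factors of the product exceed 1. The bound is
    crude, but uniform in [n] and [x]. *)
Lemma greedy_digit_bound (x : R) n : (0 < p)%N -> 0 <= x < 1 ->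
  0 <= ((greedy_digit beta x n)%:~R : R) <= base_prod p.
Proof.
move=> p0 x01; have /andP[r0 r1] := greedy_remainder_bound _ n x01.
have b0 := base_at_gt0 n.
rewrite ler0z floor_ge0 mulr_ge0 ?(ltW b0) //=.
apply: le_trans (real_floor_le (num_real _)) _.
apply: le_trans (_ : base_at beta n <= _).
  by rewrite ger_pMr // ltW.
have np : (n %% p < p)%N by rewrite ltn_mod.
have -> : base_at beta n = base_at beta (n %% p) by rewrite /base_at modn_mod.
apply: le_trans (base_prod_le _ _ np); rewrite base_prodS ler_peMl //.
  exact: ltW (base_at_gt0 _).
by rewrite -base_prod0 base_prod_le.
Qed.
End Greedy.

Arguments base_prod {R p} beta n.

(** * The modulus on [R[i]] *)

Lemma normc_real (R : realType) (x : R) : ComplexField.Normc.normc x%:C%C = `|x|.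
Proof. by rewrite /ComplexField.Normc.normc /= expr0n addr0 sqrtr_sqr. Qed.

Lemma normcX (R : realType) (z : R[i]) n :
  ComplexField.Normc.normc (z ^+ n) = ComplexField.Normc.normc z ^+ n.
Proof.
elim: n => [|n IHn]; first exact: ComplexField.Normc.normc1.
by rewrite !exprS ComplexField.Normc.normcM IHn.
Qed.

Lemma normc_triangle (R : realType) (u v : R[i]) :
  ComplexField.Normc.normc (u + v) <=
  ComplexField.Normc.normc u + ComplexField.Normc.normc v.
Proof. exact: le_normcD. Qed.

Lemma normc_opp (R : realType) (u : R[i]) :
  ComplexField.Normc.normc (- u) = ComplexField.Normc.normc u.
Proof. exact: normcN. Qed.

Lemma normc_nonneg (R : realType) (u : R[i]) : 0 <= ComplexField.Normc.normc u.
Proof. by case: u => a c; exact: sqrtr_ge0. Qed.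

(** * Remainders under the conjugate embedding *)

Section Conjugate.
Variables (R : realType) (p : nat) (beta : p.-tuple R).
Hypothesis p_gt0 : (0 < p)%N.
Hypothesis beta_gt1 : forall n, 1 < base_at beta n.
(** [A] is a ring of lifts of elements of Q(b), later [{poly rat}], with [psi] in the role of sigma
    after [phi]. By [phi_ker] the value of [psi] depends only on that of [phi], so no map on a
    subfield of [R] has to be built. *)
Variables (A : comNzRingType).
Variables (phi : {rmorphism A -> R}) (psi : {rmorphism A -> R[i]}).
Hypothesis phi_ker : forall a, phi a = 0 -> psi a = 0.
Hypothesis rational_lift : forall y : R, rational y ->
  exists a, phi a = y /\ psi a = y%:C%C.
Variable h : nat -> A.
Hypothesis phi_h : forall n, phi (h n) = base_at beta n.
Variable X : A.
Hypothesis phi_X : phi X = base_prod beta p.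

Local Notation r := (greedy_remainder beta).
Local Notation normc := ComplexField.Normc.normc.
Local Notation b := (base_prod beta p).
Local Notation z := (psi X).

Hypothesis z_gt1 : 1 < normc z.

Lemma conj_eq a c : phi a = phi c -> psi a = psi c.
Proof.
move=> /eqP; rewrite -subr_eq0 -rmorphB => /eqP/phi_ker; rewrite rmorphB.
by move=> /eqP; rewrite subr_eq0 => /eqP.
Qed.

(** The digits are a parameter: [A] has no floor, and the error bound below can be uniform in
    them. *)
Fixpoint lift_remainder (a : A) (e : nat -> int) n : A :=
  if n is m.+1 then h m * lift_remainder a e m - (e m)%:~R else a.

Lemma phi_lift_remainder a n :
  phi (lift_remainder a (greedy_digit beta (phi a)) n) = r (phi a) n.
Proof.
by elim: n => //= n IHn; rewrite rmorphB rmorphM rmorph_int IHn phi_h.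
Qed.

(** The error obeys an affine recurrence in [i] whose coefficients do not depend on [n], since the
    base has period [p]. Hence one [C] serves all [a], [e] and [n]. *)
Lemma lift_remainder_block i : exists2 C, 0 <= C & forall a e n,
  (forall m, 0 <= ((e m)%:~R : R) <= b) ->
  normc (psi (lift_remainder a e (n * p + i)) -
         psi (\prod_(j < i) h j) * psi (lift_remainder a e (n * p))) <= C.
Proof.
elim: i => [|i [C C0 IHi]].
  exists 0 => // a e n _; rewrite addn0 big_ord0 rmorph1 mul1r subrr.
  by rewrite ComplexField.Normc.normc0.
exists (normc (psi (h i)) * C + b).
  by rewrite addr_ge0 ?mulr_ge0 ?normc_nonneg // ltW // base_prod_gt0.
move=> a e n eb; rewrite addnS /= big_ord_recr /= !rmorphB !rmorphM /= rmorph_int.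
(* These may be different lifts of the same base element; only their images must agree. *)
have -> : psi (h (n * p + i)) = psi (h i).
  by apply: conj_eq; rewrite !phi_h /base_at modnMDl.
set u := psi (lift_remainder a e (n * p + i)) in IHi *.
set v := psi (lift_remainder _ _ _); set w := psi (\prod_(j < i) h j).
have -> : psi (h i) * u - (e (n * p + i))%:~R - w * psi (h i) * v =
    psi (h i) * (u - w * v) + - (e (n * p + i))%:~R by ring.
apply: le_trans (normc_triangle _ _ _) _; rewrite normc_opp.
rewrite ComplexField.Normc.normcM lerD ?ler_wpM2l ?normc_nonneg ?IHi //.
have /andP[e0 eB] := eb (n * p + i)%N.
by rewrite -(rmorph_int (real_complex R)) normc_real ger0_norm.
Qed.

Lemma psi_prod_block : psi (\prod_(j < p) h j) = z.
Proof.
by apply: conj_eq; rewrite phi_X rmorph_prod; apply: eq_bigr => i _; rewrite phi_h.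
Qed.

(* Above [C / (|z| - 1)] the conjugate remainders would grow strictly forever. *)
Lemma conj_remainder_bound : exists2 K, 0 <= K & forall a n, Per beta (phi a) ->
  normc (psi (lift_remainder a (greedy_digit beta (phi a)) (n * p))) <= K.
Proof.
have [C C0 hC] := lift_remainder_block p.
have z0 : 0 < normc z - 1 by rewrite subr_gt0.
exists (C / (normc z - 1)); first by rewrite divr_ge0 // ltW.
move=> a n Pa; rewrite leNgt; apply/negP => Kn.
set s := fun n => normc (psi (lift_remainder a (greedy_digit beta (phi a)) (n * p))).
have step j : C / (normc z - 1) < s j -> s j < s j.+1.
  rewrite ltr_pdivrMr // => Cs.
  have eb m : 0 <= ((greedy_digit beta (phi a) m)%:~R : R) <= b.
    by apply: greedy_digit_bound => //; case: Pa.
  have := hC a _ j eb; rewrite psi_prod_block addnC -mulSn.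
  set u := psi (lift_remainder _ _ _); set v := psi (lift_remainder _ _ _) => uv.
  have : normc (z * v) <= normc u + normc (- (u - z * v)).
    by apply: le_trans (normc_triangle _ _ _); rewrite opprB addrC subrK.
  rewrite normc_opp ComplexField.Normc.normcM => zv.
  have -> : s j.+1 = normc u by [].
  have sj : s j = normc v by [].
  rewrite sj in Cs *; lra.
have grow j : s n <= s (n + j)%N.
  elim: j => [|j IHj]; first by rewrite addn0.
  by rewrite addnS; apply: (le_trans IHj); apply/ltW/step/(lt_le_trans Kn IHj).
have incr m k : (n <= m)%N -> s m < s (m + k.+1)%N.
  move=> nm; elim: k => [|k IHk]; rewrite addnS; last apply: lt_trans IHk _.
    by rewrite addn0 -(subnKC nm); exact: step (lt_le_trans Kn (grow _)).
  rewrite -(subnKC (leq_trans nm (leq_addr k.+1 m))).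
  exact: step (lt_le_trans Kn (grow _)).
have [N [k [k0 perk]]] := Per_remainder_periodic _ _ _ beta_gt1 _ p_gt0 Pa.
(* From [maxn n N] on, both the strict growth and the periodicity apply. *)
have := incr (maxn n N) k.-1 (leq_maxl _ _); rewrite prednK //.
rewrite /s (conj_eq (lift_remainder _ _ ((maxn n N + k) * p))
                    (lift_remainder a (greedy_digit beta (phi a)) (maxn n N * p))).
  by rewrite ltxx.
by rewrite !phi_lift_remainder perk // leq_maxr.
Qed.

(** Only base elements and integer digits enter the scaled partial sum. When the remainder vanishes,
    this lifts [base_prod beta n * x]. *)
Lemma greedy_partial_sum_lift (x : R) n :
  exists e, phi e = base_prod beta n * x - r x n.
Proof.
elim: n => [|n [e phie]].
  by exists 0; rewrite rmorph0 base_prod0 mul1r subrr.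
exists (h n * e + (greedy_digit beta x n)%:~R).
rewrite rmorphD rmorphM phi_h rmorph_int phie base_prodS /greedy_digit /=; ring.
Qed.

Variables c d : R.
Hypotheses (c_ge0 : 0 <= c) (c_lt_d : c < d) (d_le1 : d <= 1).
Hypothesis Per_dense : forall u v, c <= u -> u < v -> v <= d ->
  exists y, [/\ u < y < v, Per beta y & rational y].

(** This is sigma x = x, multiplied by [z ^+ m] because lifts cannot be divided in [A]. *)
Lemma conj_finite_expansion (x : R) m e : c < x < d -> r x (m * p) = 0 ->
  phi e = b ^+ m * x -> psi e = z ^+ m * x%:C%C.
Proof.
move=> /andP[cx xd] xm phie; have [K K0 hK] := conj_remainder_bound.
have x01 : 0 <= x < 1 by rewrite (le_trans c_ge0 (ltW cx)) (lt_le_trans xd d_le1).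
have nz0 : 0 < normc z by apply: lt_trans z_gt1.
have z0 : z != 0.
  by apply: contraTneq nz0 => ->; rewrite ComplexField.Normc.normc0 ltxx.
have zX n : z ^+ n != 0 by rewrite expf_neq0.
suff : psi e / z ^+ m - x%:C%C = 0.
  by move/eqP; rewrite subr_eq0 => /eqP <-; rewrite mulrC divfK.
apply: ComplexField.Normc.eq0_normc; apply/eqP.
rewrite eq_le normc_nonneg andbT; apply/ler_addgt0Pr => eps eps0; rewrite add0r.
(* Half of [eps] bounds the distance from [y] to sigma x, the other half that from [y] to [x]. *)
have [N hN] := expr_unbounded _ _ (K / (eps / 2)) z_gt1.
set n := maxn N m.
have [del del0 hdel] := greedy_remainder_right_affine _ _ _ beta_gt1 _ (n * p) x01.
have [y [/andP[xy]]] : exists y, [/\ x < y < Num.min (x + Num.min del (eps / 2)) d,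
    Per beta y & rational y].
  apply: Per_dense; rewrite ?ge_min ?lexx ?orbT ?(ltW cx) //.
  by rewrite lt_min xd andbT ltrDl lt_min del0 divr_gt0.
rewrite lt_min -ltrBlDl lt_min => /andP[/andP[ydel yeps] yd] Py /rational_lift[a [phia psia]].
have ry : r y (n * p) = b ^+ n * (y - x).
  rewrite -(subrK x y) addrC hdel; last by apply/andP; split=> //; lra.
  rewrite (greedy_remainder_eq0 _ _ _ _ _ _ xm) ?add0r ?base_prod_mul; last first.
    by rewrite leq_mul2r leq_maxr orbT.
  by congr (_ * _); ring.
have := hK a n; rewrite phia => /(_ Py).
(* Both arguments lift [b ^+ n * (y - x)], and the image of the second under [psi] is explicit;
   [n >= m] makes the exponent [n - m] exact. *)
rewrite -phia (conj_eq _ (X ^+ n * a - X ^+ (n - m) * e)); last first.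
  rewrite phi_lift_remainder phia ry rmorphB !rmorphM !rmorphXn phia phie phi_X.
  by rewrite mulrA -exprD subnK ?leq_maxr // mulrBr.
rewrite rmorphB !rmorphM !rmorphXn psia.
have -> : z ^+ n * y%:C%C - z ^+ (n - m) * psi e =
    z ^+ n * (y%:C%C - psi e / z ^+ m).
  have zn : z ^+ n = z ^+ (n - m) * z ^+ m by rewrite -exprD subnK ?leq_maxr.
  by rewrite mulrBr {3}zn -[z ^+ (n - m) * _ * _]mulrA [z ^+ m * _]mulrC divfK.
rewrite ComplexField.Normc.normcM normcX => bnd.
have : K < normc z ^+ n * (eps / 2).
  by rewrite -ltr_pdivrMr ?divr_gt0 // hN // leq_maxl.
move=> /(le_lt_trans bnd); rewrite ltr_pM2l ?exprn_gt0 // => /ltW bnd'.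
have -> : psi e / z ^+ m - x%:C%C =
    - (y%:C%C - psi e / z ^+ m) + (y - x)%:C%C by rewrite rmorphB /=; ring.
apply: le_trans (normc_triangle _ _ _) _; rewrite normc_opp normc_real.
rewrite gtr0_norm ?subr_gt0 //; lra.
Qed.

Lemma dense_conj_eq : z = b%:C%C.
Proof.
have b1 : 1 < b by exact: base_prod_gt1.
have b0 : 0 < b by apply: lt_trans b1.
(* With this [m], truncating the midpoint [x0] at rank [m * p] moves it by less than half the length
   of the interval. *)
have [m hm] := expr_unbounded _ _ (((c + d) / 2 - c)^-1) b1.
pose x0 := (c + d) / 2.
have [[hc hcd] hd] := ((c_ge0, c_lt_d), d_le1).
have x001 : 0 <= x0 < 1 by rewrite /x0; apply/andP; split; lra.
pose x := x0 - r x0 (m * p) / base_prod beta (m * p).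
have /andP[r0 r1] := greedy_remainder_bound _ _ beta _ (m * p) x001.
have xm : r x (m * p) = 0 by apply: greedy_truncate.
have B0 : 0 < b ^+ m by rewrite exprn_gt0.
have cxd : c < x < d.
  have := hm m (leqnn m); rewrite -[_^-1]mul1r ltr_pdivrMr; last by lra.
  move=> hbm.
  have : r x0 (m * p) / b ^+ m < x0 - c.
    by rewrite ltr_pdivrMr // mulrC (lt_trans r1).
  have : 0 <= r x0 (m * p) / b ^+ m by rewrite divr_ge0 // ltW.
  rewrite /x base_prod_mul /x0; move=> *; apply/andP; split; lra.
have /andP[cx xd] := cxd.
have x01 : 0 <= x < 1 by apply/andP; split; lra.
clearbody x.
have [e] := greedy_partial_sum_lift x (m * p).
rewrite xm subr0 base_prod_mul => phie.
have psie := conj_finite_expansion _ _ _ cxd xm phie.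
have [N hN] := greedy_append_digit _ _ _ beta_gt1 _ _ p_gt0 x01 xm.
have [N' hN'] := expr_unbounded _ _ (d - x)^-1 b1.
(* Comparing the identities for [x] and for [x + b ^- n] leaves z^n b^-n = 1. *)
have zb n : (maxn m (maxn N N') <= n)%N -> z ^+ n = (b ^+ n)%:C%C.
  rewrite !geq_max => /and3P[mn Nn N'n].
  have bn0 : 0 < b ^+ n by rewrite exprn_gt0.
  have : psi (X ^+ (n - m) * e + 1) = z ^+ n * (x + b ^- n)%:C%C.
    apply: conj_finite_expansion; last 1 first.
    - rewrite rmorphD rmorphM rmorphXn phi_X rmorph1 phie mulrA -exprD subnK //.
      by rewrite mulrDr divff ?gt_eqF.
    - apply/andP; split; first by rewrite ltr_wpDr // invr_ge0 ltW.
      by rewrite -ltrBrDl invf_plt ?hN' // posrE ?subr_gt0.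
    - exact: hN.
  rewrite rmorphD rmorphM rmorphXn rmorph1 psie mulrA -exprD subnK //.
  rewrite rmorphD mulrDr => /addrI /eqP; rewrite fmorphV eq_sym.
  rewrite -/(_ / _) => /eqP E; apply/eqP.
  have bC : (b ^+ n)%:C%C != 0 :> R[i] by rewrite fmorph_eq0 gt_eqF.
  by rewrite -[_%:C%C]mul1r -E divfK.
set M := maxn m _ in zb.
(* Two consecutive exponents suffice: cancelling the common power gives z = b. *)
have := zb M.+1 (leqnSn _); rewrite !exprS rmorphM zb //.
by apply: mulIf; rewrite fmorph_eq0 gt_eqF // exprn_gt0.
Qed.
End Conjugate.

(** * Rational polynomials evaluated at a number and at its conjugate *)

Section Evaluation.
Variables (R : realType) (q : {poly rat}) (x : R) (z : R[i]).
Hypothesis q_irr : irreducible_poly q.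
Hypothesis qx : root (map_poly (ratr : rat -> R) q) x.
Hypothesis qz : root (map_poly (ratr : rat -> R[i]) q) z.

Local Notation eval F u := (horner_eval u \o map_poly (ratr : rat -> F)).

Lemma irreducible_dvd_or_bezout (f : {poly rat}) :
  (q %| f) \/ exists u v, u * f + v * q = 1.
Proof.
case: (boolP (coprimep f q)) => [/Bezout_coprimepP[[u v]] /= | ncop].
  rewrite -size_poly_eq1 => /size_poly1P[k k0 uv]; right.
  exists (k^-1 *: u), (k^-1 *: v).
  by rewrite -!scalerAl -scalerDr uv -mul_polyC -polyCM mulVf.
left; have [_ irr] := q_irr.
by rewrite -(eqp_dvdl _ (irr _ ncop (dvdp_gcdr f q))) dvdp_gcdl.
Qed.

(** A Bezout relation evaluated at [x] would give 0 = 1, so [q] divides [f]. This supplies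
    [phi_ker]. *)
Lemma eval_ker (f : {poly rat}) : eval R x f = 0 -> eval R[i] z f = 0.
Proof.
rewrite /= /horner_eval => fx.
have [/dvdpP[g ->] | [u [v uv]]] := irreducible_dvd_or_bezout f.
  by rewrite rmorphM hornerM (rootP qz) mulr0.
have := congr1 (eval R x) uv.
rewrite /= /horner_eval rmorphD !rmorphM hornerD !hornerM fx (rootP qx) !mulr0.
by rewrite addr0 rmorph1 hornerE => /eqP; rewrite eq_sym oner_eq0.
Qed.

(** The Bezout coefficient of [g] inverts it at [x], so every quotient is a polynomial value. *)
Lemma rational_adjoin_poly y : rational_adjoin x y -> exists f, eval R x f = y.
Proof.
move=> [f [g [gx ->]]].
have [/dvdpP[k gE] | [u [v uv]]] := irreducible_dvd_or_bezout g.
  by case/eqP: gx; rewrite gE rmorphM hornerM (rootP qx) mulr0.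
exists (f * u); rewrite /= /horner_eval rmorphM hornerM; congr (_ * _).
apply: (mulIf gx); rewrite mulVf //.
have := congr1 (eval R x) uv.
by rewrite /= /horner_eval rmorphD !rmorphM hornerD !hornerM (rootP qx) mulr0 addr0 rmorph1 hornerE.
Qed.
End Evaluation.

(** * Choice of the conjugate, relative topology and conclusion *)

Lemma nonPisot_nonSalem_conjugate (R : realType) (b : R) :
  algebraic_integer b -> 1 < b -> ~ pisot b -> ~ salem b ->
  exists z, [/\ galois_conjugate b z, z != b%:C%C
              & 1 < ComplexField.Normc.normc z].
Proof.
move=> bint b1 npisot nsalem; apply: contrapT => noz.
have le1 z : galois_conjugate b z -> z != b%:C%C -> ComplexField.Normc.normc z <= 1.
  by move=> gz zb; rewrite leNgt; apply/negP => z1; apply: noz; exists z.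
apply: npisot; split=> // z gz zb; rewrite lt_neqAle le1 // andbT.
by apply/eqP => z1; apply: nsalem; split=> //; exists z.
Qed.

(** The part of a relative ball to the right of its centre and below 1 is a genuine interval; a gap
    of [S] inside it contains a point outside the closure. *)
Lemma not_nowhere_dense_interval (R : realType) (S : set R) :
  S `<=` `[0, 1[ -> (forall c d : R, 0 <= c -> c < d -> d <= 1 ->
    exists u v, [/\ c <= u, u < v, v <= d & forall y, u < y < v -> ~ S y]) ->
  nowhere_dense_in (`[0, 1[%classic : set R) S.
Proof.
move=> S01 gap; split=> //; rewrite /nowhere_dense -subset0 => x /= xint.
have x01 : (`[0, 1[%classic : set R) x.
  have /= xcl : closure (S : set (subspace (`[0, 1[%classic : set R))) x.
    exact: interior_subset xint.
  (* A point outside the subspace is isolated, so it lies in the closure only if it lies in [S]. *)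
  apply: contrapT => nx; have : nbhs (x : subspace (`[0, 1[%classic : set R)) [set x].
    by rewrite /nbhs /= -nbhs_subspace_out.
  by move=> /xcl[y [Sy /= yx]]; apply: nx; rewrite -yx; exact: S01.
move: (xint); rewrite /interior /nbhs /= -nbhs_subspace_in //.
rewrite /within /= => /nbhs_ballP[e /= e0 ball_cl].
move: (x01); rewrite /= in_itv /= => /andP[x0 x1].
have xlt : x < Num.min (x + e) 1 by rewrite lt_min x1 ltrDl e0.
have /(gap _ _ x0 xlt)[u [v [xu uv vd Suv]]] : Num.min (x + e) 1 <= 1.
  by rewrite ge_min lexx orbT.
move: vd; rewrite le_min => /andP[vxe v1].
pose y := (u + v) / 2.
have uyv : u < y < v by rewrite /y; apply/andP; split; lra.
have /andP[uy yv] := uyv.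
have y01 : (`[0, 1[%classic : set R) y by rewrite /= in_itv /=; apply/andP; split; lra.
have : closure (S : set (subspace (`[0, 1[%classic : set R))) y.
  apply: ball_cl => //; rewrite /ball /= distrC ger0_norm; lra.
have : nbhs (y : subspace (`[0, 1[%classic : set R)) [set t | u < t < v].
  rewrite /nbhs /= -nbhs_subspace_in // /within /=.
  have : nbhs y (`]u, v[%classic : set R) by apply: near_in_itvoo; rewrite in_itv.
  by apply: filterS => t; rewrite /= in_itv.
by move=> nb /(_ _ nb)[t [St]] /Suv.
Qed.

Theorem theorem3 (R : realType) (p : nat) (beta : p.-tuple R)
  (hp : (1 <= p)%N) (hbeta : alternate_base beta)
  (b : R) (hb : b = \prod_(i < p) tnth beta i)
  (hQ : forall i : 'I_p, rational_adjoin b (tnth beta i))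
  (hint : algebraic_integer b) (hpisot : ~ pisot b) (hsalem : ~ salem b) :
  nowhere_dense_in (`[0, 1[ : set R) (Per beta `&` rational).
Proof.
have base_tnth n : exists i, base_at beta n = tnth beta i.
  have np : (n %% p < p)%N by rewrite ltn_mod.
  by exists (Ordinal np); rewrite (tnth_nth 0).
have beta_gt1 n : 1 < base_at beta n.
  by have [i ->] := base_tnth n; exact: hbeta.
have bE : b = base_prod beta p.
  rewrite hb; apply: eq_bigr => i _.
  by rewrite /base_at modn_small // (tnth_nth 0).
have b1 : 1 < b by rewrite bE; exact: base_prod_gt1.
have [z [[q [_ qirr qb qz]] zb z1]] := nonPisot_nonSalem_conjugate _ _ hint b1 hpisot hsalem.
have /choice[h hE] n : exists f : {poly rat},
    (horner_eval b \o map_poly (ratr : rat -> R)) f = base_at beta n.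
  by have [i ->] := base_tnth n; exact: rational_adjoin_poly qirr qb _ (hQ i).
apply: not_nowhere_dense_interval => [x [[x01 _] _] | c d c0 cd d1].
  by rewrite /= in_itv.
(* The absence of a gap between [c] and [d] is the hypothesis [Per_dense]. *)
apply: contrapT => nogap; case/eqP: zb.
have X_z : (horner_eval z \o map_poly (ratr : rat -> R[i])) 'X = z.
  by rewrite /= /horner_eval map_polyX hornerX.
rewrite -[LHS]X_z bE.
apply: (dense_conj_eq _ _ _ hp beta_gt1 _
  (horner_eval b \o map_poly (ratr : rat -> R))
  (horner_eval z \o map_poly (ratr : rat -> R[i]))
  (eval_ker _ _ _ _ qirr qb qz) _ h hE 'X _ _ c d) => //.
(* Rationals lift to constant polynomials, on which both evaluations agree. *)
- move=> y [s _ <-]; exists s%:P; rewrite /= /horner_eval !map_polyC !hornerC.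
  by split=> //; rewrite fmorph_rat.
- by rewrite /= /horner_eval map_polyX hornerX.
- by rewrite /= /horner_eval map_polyX hornerX.
move=> u v cu uv vd; apply: contrapT => noy; apply: nogap.
exists u, v; split=> // y uyv [Py ry]; apply: noy; by exists y.
Qed.
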